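(* Let $N\geq 2$ be even and $M_2=N/2$. For any non-zero choice of $(b_1,b_2)\in\mathbb{Z}_N^2$ with $\gcd(b_1,b_2,M_2)=1$, the linear code $C$ over $\mathbb{Z}_N$ generated by the rows of $$\begin{pmatrix} M_2 & 0 & M_2 & b_1 & -b_1 \\ {} M_2 & M_2 & 0 & b_2 & -b_2 \end{pmatrix}$$ is either a direct sum or it is isomorphic to the code generated by the rows of $$g=\begin{pmatrix} M_2 & M_2 & 0 & 0 & 0 \\ {} M_2 & 0 & M_2 & 1 & N-1 \end{pmatrix}.$$ The simplex $\Delta_C$ corresponding to the latter code has $h^*(\Delta_C,t)=\left(\tfrac{3N}{2}-1\right)t^2+\tfrac N2t+1$.
   Context: $\mathbb{Z}_N=\mathbb{Z}/N\mathbb{Z}$, with elements identified with the representatives $0,\dots,N-1$. A linear code of length $n$ over $\mathbb{Z}_N$ is a submodule of $\mathbb{Z}_N^n$. Two codes over the same $\mathbb{Z}_N$ and of the same length are isomorphic if they coincide after a permutation of coordinates. Direct sum: for codes $C_1$ over $\mathbb{Z}_{N_1}$ and $C_2$ over $\mathbb{Z}_{N_2}$, of lengths $\ge1$, with $L=\operatorname{lcm}(N_1,N_2)$, $C_1\oplus C_2$ is the code over $\mathbb{Z}_L$ consisting of all concatenations $\frac{L}{N_1}c_1\,|\,\frac{L}{N_2}c_2$, $c_i\in C_i$. A code is a direct sum if it is isomorphic to some $C_1\oplus C_2$. Simplex of a code: for a code $C\subseteq\mathbb{Z}_N^{d+1}$ all of whose words have coordinate sum $0\bmod N$, let $M=\pi^{-1}(C)\subseteq\mathbb{Z}^{d+1}$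 with $\pi:\mathbb{Z}^{d+1}\to\mathbb{Z}_N^{d+1}$ the reduction map, and $\Delta_C=\operatorname{conv}(Ne_0,\dots,Ne_d)$, viewed as a $d$-dimensional lattice simplex with respect to the affine lattice $\operatorname{aff}(Ne_0,\dots,Ne_d)\cap M$. For a $d$-dimensional lattice polytope $\Delta$ with lattice $M'$, $h^*(\Delta,t)$ is defined by $1+\sum_{k\ge1}|k\Delta\cap M'|t^k=h^*(\Delta,t)/(1-t)^{d+1}$; for $\Delta_C$ one has $h^*(\Delta_C,t)=\sum_{c\in C}t^{\frac1N\sum_i c_i}$. *)

(* Defs.v *)
From mathcomp Require Import all_boot all_order all_algebra finmap.
From mathcomp Require Import boolp classical_sets cardinality reals.

Set Implicit Arguments.
Unset Strict Implicit.
Unset Printing Implicit Defensive.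

Import GRing.Theory.
Local Open Scope ring_scope.

(* The third clause is automatic for N >= 2. It makes N = 1 correct as well:
   'Z_1 is the ring Z/2, but the only representative of a class mod 1 is 0. *)
Definition linear_code (N n : nat) (C : {set 'rV['Z_N]_n}) : Prop :=
  [/\ (0 < N)%N, submod_closed [in C]
    & forall c, c \in C -> forall i, (c ord0 i < N)%N].
Arguments linear_code N {n} C.

Definition row_code (N m n : nat) (G : 'M['Z_N]_(m, n)) : {set 'rV['Z_N]_n} :=
  [set u *m G | u : 'rV['Z_N]_m].

(* The bijection s forces m = n. Two lengths are allowed so that codes of
   length n1 + n2 and of length n can be compared without a cast. *)
Definition code_iso (N m n : nat)
    (C : {set 'rV['Z_N]_m}) (D : {set 'rV['Z_N]_n}) : Prop :=
  exists2 s : 'I_n -> 'I_m, bijective s & D = [set colsub s c | c in C].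

(* c |-> (L / N) c, computed on the representatives 0, ..., N - 1; meant for
   N dividing L. *)
Definition scale_word (L N n : nat) (c : 'rV['Z_N]_n) : 'rV['Z_L]_n :=
  map_mx (fun x : 'Z_N => (L %/ N * x)%:R) c.
Arguments scale_word L N {n} c.

(* Meant for L = lcmn N1 N2; L is a parameter to avoid casts between rings. *)
Definition direct_sum (L N1 N2 n1 n2 : nat)
    (C1 : {set 'rV['Z_N1]_n1}) (C2 : {set 'rV['Z_N2]_n2}) :
    {set 'rV['Z_L]_(n1 + n2)} :=
  [set row_mx (scale_word L N1 c1) (scale_word L N2 c2) | c1 in C1, c2 in C2].
Arguments direct_sum L N1 N2 {n1 n2} C1 C2.

Definition is_direct_sum (N n : nat) (C : {set 'rV['Z_N]_n}) : Prop :=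
  exists (N1 N2 n1 n2 : nat)
         (C1 : {set 'rV['Z_N1]_n1}) (C2 : {set 'rV['Z_N2]_n2}),
    [/\ (0 < n1)%N /\ (0 < n2)%N, linear_code N1 C1, linear_code N2 C2,
        N = lcmn N1 N2 & code_iso (direct_sum N N1 N2 C1 C2) C].
Arguments is_direct_sum N {n} C.

Definition mx_of_seqs (A : nmodType) (m n : nat) (s : seq (seq A)) :
    'M[A]_(m, n) :=
  \matrix_(i < m, j < n) (nth [::] s i)`_j.

Definition gen_b (N : nat) (b1 b2 : 'Z_N) : 'M['Z_N]_(2, 5) :=
  let M2 : 'Z_N := N./2%:R in
  mx_of_seqs 2 5 [:: [:: M2;  0; M2; b1; - b1];
                     [:: M2; M2;  0; b2; - b2]].

Definition gen_g (N : nat) : 'M['Z_N]_(2, 5) :=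
  let M2 : 'Z_N := N./2%:R in
  mx_of_seqs 2 5 [:: [:: M2; M2;  0; 0; 0];
                     [:: M2;  0; M2; 1; (N - 1)%:R]].

Local Open Scope classical_set_scope.

Definition affine_hull (R : realType) (m n : nat) (v : 'I_m -> 'rV[R]_n) :
    set 'rV[R]_n :=
  [set x | exists a : 'I_m -> R,
     \sum_i a i = 1 /\ x = \sum_i a i *: v i].

Definition convex_hull (R : realType) (m n : nat) (v : 'I_m -> 'rV[R]_n) :
    set 'rV[R]_n :=
  [set x | exists a : 'I_m -> R,
     [/\ forall i, 0 <= a i, \sum_i a i = 1 & x = \sum_i a i *: v i]].

(* |k P \cap A| for an affine lattice A, viewed as a lattice with origin p \in A:
   k P is the dilate of P with centre p. The count does not depend on p. *)
Definition ehrhart (R : realType) (n : nat)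
    (P A : set 'rV[R]_n) (p : 'rV[R]_n) (k : nat) : nat :=
  let kP := [set p + k%:R *: (x - p) | x in P] in
  #|` fset_set (kP `&` A)|%fset.

Definition ehrhart_series (R : realType) (n : nat)
    (P A : set 'rV[R]_n) (p : 'rV[R]_n) (k : nat) : nat :=
  if k is 0 then 1 else ehrhart P A p k.

(* The defining identity of h*, with the denominator (1 - t)^(d+1) cleared and
   coefficients of t^k compared. *)
Definition is_hstar (R : realType) (d n : nat)
    (P A : set 'rV[R]_n) (p : 'rV[R]_n) (h : {poly rat}) : Prop :=
  forall k : nat,
    h`_k = \sum_(i < k.+1)
             ((1 - 'X) ^+ d.+1 : {poly rat})`_i
             * (ehrhart_series P A p (k - i))%:R.

Definition simplex_vertex (R : realType) (N d : nat) (i : 'I_d.+1) :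
    'rV[R]_d.+1 :=
  N%:R *: delta_mx 0 i.
Arguments simplex_vertex R N {d} i.

Definition preimage_lattice (N n : nat) (C : {set 'rV['Z_N]_n}) :
    set 'rV[int]_n :=
  [set z | map_mx (fun x : int => x%:~R : 'Z_N) z \in C].

Definition code_simplex (R : realType) (N d : nat) : set 'rV[R]_d.+1 :=
  convex_hull (simplex_vertex R N (d := d)).
Arguments code_simplex : clear implicits.

Definition code_lattice (R : realType) (N d : nat)
    (C : {set 'rV['Z_N]_d.+1}) : set 'rV[R]_d.+1 :=
  affine_hull (simplex_vertex R N (d := d)) `&`
  [set map_mx (fun x : int => x%:~R : R) z | z in preimage_lattice C].
Arguments code_lattice R N {d} C.

Definition code_hstar (R : realType) (N d : nat)
    (C : {set 'rV['Z_N]_d.+1}) (h : {poly rat}) : Prop :=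
  is_hstar d (code_simplex R N d) (code_lattice R N C)
    (simplex_vertex R N ord0) h.
Arguments code_hstar R N {d} C h.

(* Main.v *)
(** Write M = N/2. Since M x only depends on the parity of x, a word of C is
    determined by the parities of two coefficients a, b and by
    x = a b1 + b b2, and gcd(b1, b2, N) is 1 or 2.

    If b1 or b2 is odd, the gcd is 1, so x takes every value, and the parity of
    x equals that of a, b or a + b. Moving (a, b) along (b2, -b1) shows that
    this is the only constraint, which describes the code of g up to a
    transposition of the first three columns. If b1 and b2 are both even, M is
    odd, and by the Chinese remainder theorem the parities are independent of
    the even number x: C is the sum of the even weight code of length 3 over
    Z_2 and of the code {(h, -h)} over Z_M.

    For the h*-polynomial, a lattice point of the k-th dilate of the simplex is
    a vector of nonnegative integers with sum k N which reduces to a codeword;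
    dividing its coordinates by N splits it uniquely into a codeword c and an
    arbitrary w in N^(d+1) with height(c) + |w| = k, so that the Ehrhart series
    is the sum of t^height(c) / (1 - t)^(d+1) over the codewords c. *)

Require Import Defs.
From mathcomp Require Import all_boot all_order all_algebra finmap.
From mathcomp Require Import classical_sets cardinality reals.
From mathcomp Require Import perm zify ring.

Set Implicit Arguments.
Unset Strict Implicit.
Unset Printing Implicit Defensive.

Import Order.TTheory GRing.Theory Num.Theory.
Local Open Scope ring_scope.

(** * Words of the two codes of length 5 *)

Definition row5 (A : nmodType) (a b c d e : A) : 'rV[A]_5 :=
  \row_j [:: a; b; c; d; e]`_j.

Lemma row_codeP (N n : nat) (G : 'M['Z_N]_(2, n)) (c : 'rV['Z_N]_n) :
  reflect (exists a b : 'Z_N, c = a *: row ord0 G + b *: row ord_max G)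
          (c \in row_code G).
Proof.
apply: (iffP imsetP) => [[u _ ->]|[a [b ->]]].
  exists (u ord0 ord0), (u ord0 ord_max); apply/rowP => j.
  rewrite !mxE !big_ord_recl big_ord0 addr0 /=.
  by congr (_ * _ + u _ _ * G _ _); apply/val_inj.
exists (\row_j [:: a; b]`_j) => //; apply/rowP => j.
rewrite !mxE !big_ord_recl big_ord0 addr0 /= !mxE /=.
by congr (_ * _ + _ * G _ _); apply/val_inj.
Qed.

Lemma row_code_gen_bP (N : nat) (b1 b2 : 'Z_N) (c : 'rV['Z_N]_5) :
  let M2 : 'Z_N := N./2%:R in
  reflect (exists x y : 'Z_N,
             c = row5 (M2 * (x + y)) (M2 * y) (M2 * x)
                      (x * b1 + y * b2) (- (x * b1 + y * b2)))
          (c \in row_code (gen_b b1 b2)).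
Proof.
move=> M2; apply: (iffP (row_codeP _ _)) => -[x [y ->]]; exists x, y;
  apply/rowP => -[[|[|[|[|[|j]]]]] lt_j] //; rewrite !mxE /= -?/M2; ring.
Qed.

Lemma row_code_gen_gP (N : nat) (c : 'rV['Z_N]_5) :
  (1 < N)%N ->
  let M2 : 'Z_N := N./2%:R in
  reflect (exists x y : 'Z_N,
             c = row5 (M2 * (x + y)) (M2 * x) (M2 * y) y (- y))
          (c \in row_code (gen_g N)).
Proof.
move=> N1 M2.
have N1R : (N - 1)%:R = -1 :> 'Z_N.
  by rewrite natrB ?(ltnW N1) // pchar_Zp // sub0r.
apply: (iffP (row_codeP _ _)) => -[x [y ->]]; exists x, y;
  apply/rowP => -[[|[|[|[|[|j]]]]] lt_j] //; rewrite !mxE /= -?/M2 ?N1R; ring.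
Qed.

(** * Bezout relations and multiples of [N / 2] in ['Z_N] *)

Lemma Zp_Bezout (N : nat) (b1 b2 : 'Z_N) : (1 < N)%N ->
  exists u v : 'Z_N, u * b1 + v * b2 = (gcdn (gcdn b1 b2) N)%:R.
Proof.
move=> N1.
(* Integer Bezout is applied twice, to [b1], [b2] and then to their gcd and [N]; the multiple of [N]
   vanishes in ['Z_N]. *)
have [u [v uvE]] := Bezoutz b1 b2.
have [u' [v' uvE']] := Bezoutz (gcdn b1 b2) N.
exists (u' * u)%:~R, (u' * v)%:~R.
have castE (b : 'Z_N) : b = (b : nat)%:Z%:~R by rewrite -[LHS]natr_Zp.
rewrite {1}[b1]castE {1}[b2]castE.
transitivity ((gcdn (gcdn b1 b2) N)%:Z%:~R : 'Z_N) => //.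
rewrite -/(gcdz (gcdn b1 b2) N) -uvE' -/(gcdz b1 b2) -uvE.
rewrite !rmorphD /= !rmorphM /= !rmorphD /= !rmorphM /=.
rewrite (_ : N%:~R = 0 :> 'Z_N); last by rewrite -pmulrn pchar_Zp.
ring.
Qed.

Lemma half_mul2 (N : nat) : (1 < N)%N -> ~~ odd N -> N./2%:R * 2 = 0 :> 'Z_N.
Proof. by move=> N1 Ne; rewrite -natrM muln2 even_halfK // pchar_Zp. Qed.

Lemma half_mulE (N : nat) (x : 'Z_N) : (1 < N)%N -> ~~ odd N ->
  N./2%:R * x = (odd x)%:R * N./2%:R.
Proof.
move=> N1 Ne; rewrite -[LHS](congr1 _ (natr_Zp x)) -[in LHS](odd_double_half x).
rewrite natrD mulrDr -mul2n natrM mulrA half_mul2 // mul0r addr0.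
exact: mulrC.
Qed.

(** * Isomorphism with the code of [g] when [b1] or [b2] is odd *)

Lemma code_iso_colsub (N m n : nat) (C : {set 'rV['Z_N]_m})
    (D : {set 'rV['Z_N]_n}) (s : 'I_n -> 'I_m) :
  bijective s -> (forall c, c \in C -> colsub s c \in D) ->
  (forall d, d \in D -> exists2 c, c \in C & d = colsub s c) -> code_iso C D.
Proof.
move=> s_bij sub_CD sub_DC; exists s => //; apply/setP => d.
apply/idP/imsetP => [/sub_DC //|[c /sub_CD cD ->] //].
Qed.

Lemma colsub_id_row5 (A : nmodType) (a b c d e : A) :
  colsub id (row5 a b c d e) = row5 a b c d e.
Proof. by apply/rowP => j; rewrite !mxE. Qed.

Lemma colsub_tperm02_row5 (A : nmodType) (a b c d e : A) :
  colsub (tperm (@Ordinal 5 0 isT) (@Ordinal 5 2 isT)) (row5 a b c d e)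
  = row5 c b a d e.
Proof.
by apply/rowP => -[[|[|[|[|[|j]]]]] lt_j] //; rewrite !mxE permE.
Qed.

Lemma colsub_tperm12_row5 (A : nmodType) (a b c d e : A) :
  colsub (tperm (@Ordinal 5 1 isT) (@Ordinal 5 2 isT)) (row5 a b c d e)
  = row5 a c b d e.
Proof.
by apply/rowP => -[[|[|[|[|[|j]]]]] lt_j] //; rewrite !mxE permE.
Qed.

Lemma perm_bijective (T : finType) (s : {perm T}) : bijective s.
Proof. exact: injF_bij (@perm_inj _ s). Qed.

Lemma coprime_even (m n : nat) :
  ~~ odd n -> odd m -> coprime m n./2 -> coprime m n.
Proof.
move=> /even_halfK {2}<- m_odd cop.
by rewrite -muln2 coprimeMr cop coprimen2.
Qed.

Lemma gen_b_iso_gen_g (N : nat) (b1 b2 : 'Z_N) :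
  (1 < N)%N -> ~~ odd N -> odd b1 || odd b2 ->
  coprime (gcdn b1 b2) N./2 ->
  code_iso (row_code (gen_b b1 b2)) (row_code (gen_g N)).
Proof.
move=> N1 Ne b_odd cop.
have [u [v uv1]] : exists u v : 'Z_N, u * b1 + v * b2 = 1.
  have [u [v uvE]] := Zp_Bezout b1 b2 N1; exists u, v; rewrite {}uvE.
  suff /eqP -> : coprime (gcdn b1 b2) N by [].
  apply: coprime_even => //; case/orP: b_odd; apply: dvdn_odd.
    exact: dvdn_gcdl.
  exact: dvdn_gcdr.
pose M2 : 'Z_N := N./2%:R.
have M2dbl (z w : 'Z_N) : M2 * w + M2 * 2 * z = M2 * w.
  by rewrite half_mul2 // mul0r addr0.
have M2b (b : 'Z_N) : M2 * b = (odd b)%:R * M2 by exact: half_mulE.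
(* (b2, - b1) spans the relations between b1 and b2: adding a multiple of it
   corrects a parity without changing a * b1 + b * b2. *)
have solve1 : odd b1 -> forall x y : 'Z_N, exists a b : 'Z_N,
    a * b1 + b * b2 = y /\ M2 * b = M2 * x.
  move=> b1o x y; pose t := x + v * y.
  (* As [b1] is odd, [t * b1] has the parity of [t], so the second coefficient is congruent to
     [v * y + t], hence to [x], mod 2. *)
  exists (u * y - t * b2), (v * y + t * b1).
  split; first by rewrite -[RHS]mulr1 -uv1; ring.
  move: (M2b b1); rewrite b1o mul1r => M2b1.
  by rewrite -[RHS](M2dbl (v * y)) /t; ring: M2b1.
have solve2 : odd b2 -> forall x y : 'Z_N, exists a b : 'Z_N,
    a * b1 + b * b2 = y /\ M2 * a = M2 * x.
  move=> b2o x y; pose t := x + u * y.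
  exists (u * y + t * b2), (v * y - t * b1).
  split; first by rewrite -[RHS]mulr1 -uv1; ring.
  move: (M2b b2); rewrite b2o mul1r => M2b2.
  by rewrite -[RHS](M2dbl (u * y)) /t; ring: M2b2.
have M2x (x y : 'Z_N) : M2 * (x * b1 + y * b2) = (M2 * b1) * x + (M2 * b2) * y.
  by ring.
(* In the three cases left, [x * b1 + y * b2] has the parity of [x + y], [x] or [y]. The column
   showing this parity is the first, third or second one, and the permutation moves it to the third
   place, as in [g]. *)
case b1o: (odd b1); case b2o: (odd b2); move: b_odd (M2b b1) (M2b b2);
  rewrite b1o b2o ?mul1r ?mul0r // => _ M2b1 M2b2.
- apply: (code_iso_colsub (perm_bijective
      (tperm (@Ordinal 5 0 isT) (@Ordinal 5 2 isT)))) => c.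
    case/row_code_gen_bP => x [y ->]; apply/row_code_gen_gP => //.
    exists y, (x * b1 + y * b2); rewrite colsub_tperm02_row5 -/M2.
    rewrite [M2 * (y + _)]mulrDr !M2x M2b1 M2b2 -[in LHS](M2dbl y x).
    by congr row5; ring.
  case/(row_code_gen_gP _ N1) => x [y ->].
  have [a [b [<- bE]]] := solve1 b1o x y.
  eexists; first by apply/row_code_gen_bP; exists a, b.
  rewrite colsub_tperm02_row5 -/M2 [M2 * (x + _)]mulrDr -bE !M2x M2b1 M2b2.
  by rewrite -[in RHS](M2dbl b a); congr row5; ring.
- apply: (code_iso_colsub (s := id)) => [|c|]; first by exists id.
    case/row_code_gen_bP => x [y ->]; apply/row_code_gen_gP => //.
    exists y, (x * b1 + y * b2); rewrite colsub_id_row5 -/M2.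
    rewrite [M2 * (y + _)]mulrDr !M2x M2b1 M2b2.
    by congr row5; ring.
  move=> c /(row_code_gen_gP _ N1) [x [y ->]].
  have [a [b [<- bE]]] := solve1 b1o x y.
  eexists; first by apply/row_code_gen_bP; exists a, b.
  rewrite colsub_id_row5 -/M2 [M2 * (x + _)]mulrDr -bE !M2x M2b1 M2b2.
  by congr row5; ring.
- apply: (code_iso_colsub (perm_bijective
      (tperm (@Ordinal 5 1 isT) (@Ordinal 5 2 isT)))) => c.
    case/row_code_gen_bP => x [y ->]; apply/row_code_gen_gP => //.
    exists x, (x * b1 + y * b2); rewrite colsub_tperm12_row5 -/M2.
    rewrite [M2 * (x + (_ + _))]mulrDr !M2x M2b1 M2b2.
    by congr row5; ring.
  case/(row_code_gen_gP _ N1) => x [y ->].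
  have [a [b [<- aE]]] := solve2 b2o x y.
  eexists; first by apply/row_code_gen_bP; exists a, b.
  rewrite colsub_tperm12_row5 -/M2 [M2 * (x + _)]mulrDr -aE !M2x M2b1 M2b2.
  by congr row5; ring.
Qed.

(** * Direct sum decomposition when [b1] and [b2] are even *)

Lemma row_code_linear (N m n : nat) (G : 'M['Z_N]_(m, n)) :
  (1 < N)%N -> linear_code N (row_code G).
Proof.
move=> N1; split; first exact: ltnW.
  split; first by apply/imsetP; exists 0; rewrite ?mul0mx.
  move=> a _ _ /imsetP[u _ ->] /imsetP[v _ ->]; apply/imsetP.
  by exists (a *: u + v); rewrite // mulmxDl scalemxAl.
by move=> c _ i; rewrite -[X in (_ < X)%N](Zp_cast N1).
Qed.

Section ScaleLetter.

Variables (L N : nat).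
Hypotheses (L1 : (1 < L)%N) (N1 : (1 < N)%N) (dvd_NL : (N %| L)%N).

Definition scale_letter (x : 'Z_N) : 'Z_L := (L %/ N * x)%:R.

(** Scaling does not depend on the representative: [L %/ N] times a multiple of [N] is a multiple of
    [L]. Additivity is then inherited from the natural numbers. *)
Lemma scale_letter_nat (m : nat) : scale_letter m%:R = (L %/ N * m)%:R.
Proof.
rewrite /scale_letter val_Zp_nat // [in RHS](divn_eq m N) mulnDr natrD.
by rewrite mulnCA divnK // [X in X + _]natrM pchar_Zp // mulr0 add0r.
Qed.

Lemma scale_letterD (x y : 'Z_N) :
  scale_letter (x + y) = scale_letter x + scale_letter y.
Proof.
by rewrite -[x]natr_Zp -[y]natr_Zp -natrD !scale_letter_nat mulnDr natrD.
Qed.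

Lemma scale_letterN (x : 'Z_N) : scale_letter (- x) = - scale_letter x.
Proof.
apply/eqP; rewrite -subr_eq0 opprK -scale_letterD addNr.
by rewrite (scale_letter_nat 0) muln0.
Qed.

End ScaleLetter.

Lemma even_weight_word (A : comNzRingType) (a b : A) :
  let G : 'M[A]_(2, 3) := mx_of_seqs 2 3 [:: [:: 1; 0; 1]; [:: 1; 1; 0]] in
  a *: row ord0 G + b *: row ord_max G = \row_j [:: a + b; b; a]`_j.
Proof.
by apply/rowP => -[[|[|[|j]]] lt_j] //; rewrite !mxE /=; ring.
Qed.

Lemma antipodal_word (A : comNzRingType) (h : A) :
  (const_mx h : 'rV_1) *m mx_of_seqs 1 2 [:: [:: 1; - 1]]
  = \row_j [:: h; - h]`_j.
Proof.
by apply/rowP => -[[|[|j]] lt_j] //; rewrite !mxE big_ord1 !mxE /=; ring.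
Qed.

Lemma gen_b_direct_sum (N : nat) (b1 b2 : 'Z_N) :
  (2 < N)%N -> ~~ odd N -> ~~ odd b1 -> ~~ odd b2 ->
  coprime (gcdn b1 b2) N./2 -> is_direct_sum N (row_code (gen_b b1 b2)).
Proof.
move=> N2 Ne b1e b2e cop; have N1 := ltnW N2.
have gcd_even : (2 %| gcdn b1 b2)%N by rewrite dvdn_gcd !dvdn2 b1e b2e.
set M := N./2 in cop *; have NE : N = (M * 2)%N by rewrite muln2 even_halfK.
have Mo : odd M.
  apply: contraT => Me; move: (@dvdn_gcd 2 (gcdn b1 b2) M).
  by rewrite (eqP cop) gcd_even (dvdn2 M) Me.
(* The bound [2 < N] enters here: ['Z_M] is the ring of residues mod [M] only for [M > 1]. *)
have M1 : (1 < M)%N by lia.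
have [u [v uv2]] : exists u v : 'Z_N, u * b1 + v * b2 = 2.
  have [u [v uvE]] := Zp_Bezout b1 b2 N1; exists u, v; rewrite {}uvE.
  suff -> : gcdn (gcdn b1 b2) N = 2%N by [].
  move: (gcdn b1 b2) cop gcd_even => g cop g_even.
  by rewrite NE Gauss_gcdr //; apply/gcdn_idPr.
pose M2 : 'Z_N := M%:R.
have M2E (b : 'Z_N) : M2 * b = (odd b)%:R * M2 by exact: half_mulE.
have M2b1 : M2 * b1 = 0 by rewrite M2E (negbTE b1e) mul0r.
have M2b2 : M2 * b2 = 0 by rewrite M2E (negbTE b2e) mul0r.
(* Since [M] is odd, [M2] is the Chinese remainder idempotent of ['Z_N]: it is 1 mod 2 and 0 mod
   [M]. *)
have M2M2 : M2 * M2 = M2.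
  by rewrite M2E /M2 val_Zp_nat // modn_small ?Mo ?mul1r //; lia.
pose G1 : 'M['Z_2]_(2, 3) := mx_of_seqs 2 3 [:: [:: 1; 0; 1]; [:: 1; 1; 0]].
pose G2 : 'M['Z_M]_(1, 2) := mx_of_seqs 1 2 [:: [:: 1; - 1]].
exists 2, M, 3, 2, (row_code G1), (row_code G2); split => //.
- exact: row_code_linear.
- exact: row_code_linear.
- have cop2M : coprime 2 M by rewrite coprime2n.
  by rewrite -[RHS]muln1 -[X in _ = (_ * X)%N](eqP cop2M) muln_lcm_gcd mulnC.
have dvd2N : (2 %| N)%N by rewrite dvdn2.
have dvdMN : (M %| N)%N by rewrite NE dvdn_mulr.
have N2M : (N %/ 2)%N = M by rewrite NE mulnK.
have NM2 : (N %/ M)%N = 2 by rewrite NE mulKn // ltnW.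
have sumE (a b : 'Z_2) (h : 'Z_M) :
    row_mx (scale_word N 2 (a *: row ord0 G1 + b *: row ord_max G1))
           (scale_word N M ((const_mx h : 'rV_1) *m G2)) =
    row5 (scale_letter N (a + b)) (scale_letter N b) (scale_letter N a)
         (scale_letter N h) (scale_letter N (- h)) :> 'rV['Z_N]_5.
  rewrite /G1 even_weight_word antipodal_word; apply/rowP => j.
  rewrite !mxE; case: splitP => k jE; rewrite !mxE jE.
    by case: k {jE} => [[|[|[|k]]] lt_k].
  by case: k {jE} => [[|[|k]] lt_k].
have sumP d : reflect (exists (a b : 'Z_2) (h : 'Z_M),
    d = row5 (scale_letter N a + scale_letter N b) (scale_letter N b)
          (scale_letter N a) (scale_letter N h) (- scale_letter N h) :> 'rV_5)
   (d \in direct_sum N 2 M (row_code G1) (row_code G2)).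
  apply: (iffP imset2P) => [[_ _ /row_codeP[a [b ->]] /imsetP[h _ ->] ->]|
                            [a [b [h ->]]]].
    pose x := h ord0 ord0; exists a, b, x.
    have -> : h = const_mx x by apply/rowP => j; rewrite !mxE ord1.
    by rewrite -scale_letterD // -scale_letterN // -sumE.
  exists (a *: row ord0 G1 + b *: row ord_max G1) (const_mx h *m G2).
  - by apply/row_codeP; exists a, b.
  - exact: imset_f.
  by rewrite -scale_letterD // -scale_letterN // sumE.
apply: (code_iso_colsub (s := id)) => [|c|].
- by exists id.
- case/sumP => a [b [h ->]]; apply/row_code_gen_bP.
  rewrite colsub_id_row5 -/M -/M2.
  pose A : 'Z_N := (a : nat)%:R; pose B : 'Z_N := (b : nat)%:R.
  pose H : 'Z_N := (h : nat)%:R.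
  (* These coefficients are [A] and [B] mod 2, and [u * H] and [v * H] mod [M]. The parity
     corrections are multiples of [M2], which kills the even [b1] and [b2], so the fourth letter
     stays [2 * H]. *)
  exists (u * H + M2 * (A - u * H)), (v * H + M2 * (B - v * H)).
  have -> : scale_letter N a = M2 * A by rewrite /scale_letter N2M natrM.
  have -> : scale_letter N b = M2 * B by rewrite /scale_letter N2M natrM.
  have -> : scale_letter N h = 2 * H by rewrite /scale_letter NM2 natrM.
  have adjust (w z : 'Z_N) : M2 * (w + M2 * (z - w)) = M2 * z.
    transitivity (M2 * w + M2 * M2 * (z - w)); first by ring.
    by rewrite M2M2; ring.
  have -> : (u * H + M2 * (A - u * H)) * b1 + (v * H + M2 * (B - v * H)) * b2
      = 2 * H.
    rewrite (_ : _ * b1 + _ * b2 = (u * b1 + v * b2) * H + M2 * b1 * (A - u * H)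
                       + M2 * b2 * (B - v * H)); last by ring.
    by rewrite uv2 M2b1 M2b2 !mul0r !addr0.
  by rewrite [in RHS]mulrDr !adjust.
- move=> c /row_code_gen_bP[x [y ->]]; rewrite -/M -/M2.
  pose b1' : 'Z_N := (b1 : nat)./2%:R; pose b2' : 'Z_N := (b2 : nat)./2%:R.
  have b1E : b1 = 2 * b1' by rewrite -natrM mul2n even_halfK // natr_Zp.
  have b2E : b2 = 2 * b2' by rewrite -natrM mul2n even_halfK // natr_Zp.
  pose h : 'Z_N := x * b1' + y * b2'.
  (* Conversely, the coefficients are reduced mod 2, and half of [x * b1 + y * b2] is reduced mod
     [M]. *)
  eexists; first by apply/sumP; exists (x : nat)%:R, (y : nat)%:R, (h : nat)%:R.
  rewrite colsub_id_row5 !scale_letter_nat // N2M NM2 !natrM !natr_Zp -/M2.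
  by rewrite /h b1E b2E; congr row5; ring.
Qed.

(** * Lattice points of the dilated simplex *)

(** The exponent of [c] in the formula for h*; the division is exact when [N] divides the coordinate
    sum, as is assumed of the codes below. *)
Definition height (N n : nat) (c : 'rV['Z_N]_n) : nat :=
  ((\sum_i c ord0 i) %/ N)%N.

Lemma sum_simplex_vertex (R : realType) (N d : nat) (a : 'I_d.+1 -> R) :
  \sum_i a i *: simplex_vertex R N i = \row_i (a i * N%:R).
Proof.
apply/rowP => j; rewrite summxE mxE (bigD1 j) //= big1 ?addr0.
  by rewrite !mxE !eqxx mulr1.
by move=> i /negPf ij; rewrite !mxE eqxx eq_sym ij !mulr0.
Qed.

Lemma sum_row_vertex0 (A : pzSemiRingType) (d : nat) (a : A) :
  \sum_(i < d.+1) a *+ (i == ord0) = a.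
Proof.
by rewrite (bigD1 ord0) //= mulr1n big1 ?addr0 // => i /negPf ->.
Qed.

(* The dilation by k centred at the vertex N e_0 is the dilation by k about the
   origin followed by the translation by - (k - 1) N e_0. *)
Lemma dilated_code_simplexP (R : realType) (N d k : nat)
    (C : {set 'rV['Z_N]_d.+1}) (y : 'rV[R]_d.+1) : (1 < N)%N -> (0 < k)%N ->
  let p := simplex_vertex R N (ord0 : 'I_d.+1) in
  ([set p + k%:R *: (x - p) | x in code_simplex R N d]
     `&` code_lattice R N C)%classic y
  <-> exists n : 'I_d.+1 -> nat,
     [/\ \sum_i n i = (k * N)%N, \row_i ((n i)%:R : 'Z_N) \in C
       & y = \row_i ((n i)%:R - (k.-1 * N)%:R *+ (i == ord0))].
Proof.
case: k => // k N1 _ p /=.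
have N0 : (N%:R : R) != 0 by rewrite pnatr_eq0; lia.
have kN0 : ((k.+1 * N)%:R : R) != 0 by rewrite pnatr_eq0; lia.
have pE i : p ord0 i = N%:R *+ (i == ord0).
  by rewrite !mxE eqxx /= mulr_natr.
split.
- move=> [[x [a [a_ge0 sum_a ->]] yE] [_ [z zC zE]]].
  have yiE i : (z ord0 i)%:~R
      = k.+1%:R * N%:R * a i - (k * N)%:R *+ (i == ord0) :> R.
    have := congr1 (fun M : 'rV_d.+1 => M ord0 i) zE.
    rewrite mxE => ->; rewrite -yE sum_simplex_vertex.
    rewrite mxE [X in _ + X]mxE [X in _ * X]mxE !mxE eqxx /= natrM.
    by case: (i == ord0) => /=; rewrite ?mulr1n ?mulr0n -natr1; ring.
  (* Here [k] is one less than the dilation factor; [m] undoes the translation by [- k N e_0] and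
     lies in the dilate about the origin. *)
  pose m i : int := z ord0 i + (k * N)%:Z *+ (i == ord0).
  have mE i : (m i)%:~R = k.+1%:R * N%:R * a i :> R.
    by rewrite rmorphD /= rmorphMn /= yiE subrK.
  have m_ge0 i : 0 <= m i.
    by rewrite -(ler0z R) mE !mulr_ge0.
  have absE i : (absz (m i))%:Z = m i by rewrite gez0_abs.
  exists (fun i => absz (m i)); split.
  + apply/eqP; rewrite -(eqr_nat R) natr_sum; apply/eqP.
    transitivity (\sum_i (k.+1%:R * N%:R * a i)).
      by apply: eq_bigr => i _; rewrite -mE -absE.
    by rewrite -mulr_sumr sum_a mulr1 natrM.
  + move: zC; rewrite /preimage_lattice /=; congr (_ \in C).
    apply/rowP => i; rewrite !mxE.
    rewrite [RHS]pmulrn absE rmorphD /= rmorphMn /= -pmulrn natrM pchar_Zp //.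
    by rewrite mulr0 mul0rn addr0.
  + rewrite -zE; apply/rowP => i; rewrite !mxE yiE.
    by rewrite [in RHS]pmulrn absE mE.
- move=> [n [sum_n nC ->]].
  have sumR : \sum_i (n i)%:R = (k.+1 * N)%:R :> R by rewrite -natr_sum sum_n.
  split.
    exists (\row_i ((n i)%:R / k.+1%:R)).
      exists (fun i => (n i)%:R / (k.+1 * N)%:R); split.
      * by move=> i; rewrite divr_ge0.
      * by rewrite -mulr_suml sumR divff.
      * rewrite sum_simplex_vertex; apply/rowP => i; rewrite !mxE natrM.
        by rewrite invfM mulrA divfK.
    apply/rowP => i; rewrite [LHS]mxE [X in _ + X]mxE [X in _ * X]mxE.
    rewrite [X in _ * (_ + X)]mxE pE !mxE /= natrM.
    case: (i == ord0) => /=; rewrite ?mulr1n ?mulr0n -natr1; field.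
      by rewrite natr1 pnatr_eq0.
    by rewrite natr1 pnatr_eq0.
  split.
    (* Affine coordinates of the translated point, some possibly negative; they sum to
       [k.+1 - k = 1]. *)
    exists (fun i => ((n i)%:R - (k * N)%:R *+ (i == ord0)) / N%:R); split.
      rewrite -mulr_suml sumrB sumR sum_row_vertex0 -natrB ?leq_mul //.
      by rewrite -mulnBl subSnn mul1n divff.
    by rewrite sum_simplex_vertex; apply/rowP => i; rewrite !mxE divfK.
  exists (\row_i ((n i)%:Z - (k * N)%:Z *+ (i == ord0))).
    rewrite /preimage_lattice /=; move: nC; congr (_ \in C).
    apply/rowP => i; rewrite !mxE rmorphB /= rmorphMn /= -!pmulrn.
    by rewrite natrM pchar_Zp // mulr0 mul0rn subr0.
  by apply/rowP => i; rewrite !mxE rmorphB /= rmorphMn /= -!pmulrn.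
Qed.

Lemma Zp_natMD (N : nat) (x : 'Z_N) (w : nat) : (1 < N)%N ->
  (w * N + x)%N%:R = x :> 'Z_N.
Proof. by move=> N1; rewrite natrD natrM pchar_Zp // mulr0 add0r natr_Zp. Qed.

Lemma ltn_Zp (N : nat) (x : 'Z_N) : (1 < N)%N -> (x < N)%N.
Proof. by move=> N1; rewrite -[X in (_ < X)%N](Zp_cast N1). Qed.

Lemma height_mul (N n : nat) (c : 'rV['Z_N]_n) :
  (N %| \sum_i (c ord0 i : nat))%N -> (\sum_i c ord0 i = height c * N)%N.
Proof. by move/divnK => ->. Qed.

(** Euclidean division of the coordinates by [N] gives the codeword as remainders and [cw.2] as
    quotients. The bound [K] keeps the quotients in a finite type, and a single [K] serves all
    [k <= K]. *)
Lemma ehrhart_code_simplex (R : realType) (N d k K : nat)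
    (C : {set 'rV['Z_N]_d.+1}) : (1 < N)%N -> (0 < k <= K)%N ->
  (forall c, c \in C -> (N %| \sum_i (c ord0 i : nat))%N) ->
  ehrhart (code_simplex R N d) (code_lattice R N C) (simplex_vertex R N ord0) k
  = #|[set cw : 'rV['Z_N]_d.+1 * {ffun 'I_d.+1 -> 'I_K.+1} |
        (cw.1 \in C) && (\sum_i cw.2 i + height cw.1 == k)%N]|.
Proof.
move=> N1 /andP[k0 kK] sum0; set S := [set _ | _]%SET.
have N0 : (0 < N)%N by exact: ltnW.
pose coord (cw : 'rV['Z_N]_d.+1 * {ffun 'I_d.+1 -> 'I_K.+1}) (i : 'I_d.+1) :=
  (cw.2 i * N + cw.1 ord0 i)%N.
pose point cw : 'rV[R]_d.+1 :=
  \row_i ((coord cw i)%:R - (k.-1 * N)%:R *+ (i == ord0)).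
have point_inj : injective point.
  move=> [c w] [c' w'] eq_p.
  have eqn i : coord (c, w) i = coord (c', w') i.
    have := congr1 (fun M : 'rV_d.+1 => M ord0 i) eq_p.
    by rewrite !mxE => /addIr/eqP; rewrite eqr_nat => /eqP.
  congr pair.
    apply/rowP => i; have := congr1 (fun m => m%:R : 'Z_N) (eqn i).
    by rewrite !Zp_natMD.
  apply/ffunP => i; apply/val_inj; have := congr1 (divn^~ N) (eqn i).
  by rewrite /= /coord /= !divnMDl // !divn_small ?ltn_Zp // !addn0.
rewrite /ehrhart /=.
have -> : ([set simplex_vertex R N ord0 + k%:R *: (x - simplex_vertex R N ord0)
     | x in code_simplex R N d] `&` code_lattice R N C)%classic
   = [set` [fset point x | x in S]%fset]%classic.
  apply/seteqP; split => y.
    move/(dilated_code_simplexP C y N1 k0) => [n [sum_n nC ->]].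
    (* Each coordinate is at most the total [k * N], so its quotient is at most [k]. *)
    have wlt i : (n i %/ N < K.+1)%N.
      rewrite ltnS (leq_trans _ kK) // -(mulnK k N0) leq_div2r // -sum_n.
      by rewrite (bigD1 i) //= leq_addr.
    pose c : 'rV['Z_N]_d.+1 := \row_i (n i)%:R.
    pose w : {ffun 'I_d.+1 -> 'I_K.+1} := [ffun i => inord (n i %/ N)].
    have cwE i : coord (c, w) i = n i.
      by rewrite /coord /= mxE ffunE inordK // val_Zp_nat // -divn_eq.
    have -> : \row_i ((n i)%:R - (k.-1 * N)%:R *+ (i == ord0)) = point (c, w).
      by apply/rowP => i; rewrite !mxE cwE.
    apply: in_imfset; rewrite /= inE /= nC /=.
    rewrite -(eqn_pmul2r N0) mulnDl -height_mul ?sum0 // big_distrl /=.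
    by rewrite -big_split /= -sum_n; apply/eqP/eq_bigr => i _; exact: cwE.
  move=> /imfsetP[[c w]] /=; rewrite inE /= => /andP[cC /eqP sumE] ->.
  apply/(dilated_code_simplexP C _ N1 k0); exists (coord (c, w)); split => //.
    by rewrite -sumE big_split /= mulnDl -height_mul ?sum0 // big_distrl.
  suff -> : \row_i (coord (c, w) i)%:R = c by [].
  by apply/rowP => i; rewrite mxE Zp_natMD.
rewrite set_fsetK card_imfset //=.
by rewrite cardE.
Qed.

Lemma row_sum_eq0 (N n : nat) (c : 'rV['Z_N]_n) :
  (\sum_i c ord0 i == 0)%N = (c == 0).
Proof.
rewrite sum_nat_eq0; apply/forallP/eqP => [c0|-> i]; last by rewrite mxE.
by apply/rowP => i; apply/val_inj; rewrite mxE; apply/eqP/c0.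
Qed.

(** At [k = 0] only the zero word with zero quotients is counted, since height 0 forces coordinate
    sum 0. This agrees with the constant term 1 of the series. *)
Lemma ehrhart_series_code_simplex (R : realType) (N d k K : nat)
    (C : {set 'rV['Z_N]_d.+1}) : (1 < N)%N -> (k <= K)%N ->
  0 \in C -> (forall c, c \in C -> (N %| \sum_i (c ord0 i : nat))%N) ->
  ehrhart_series (code_simplex R N d) (code_lattice R N C)
    (simplex_vertex R N ord0) k
  = #|[set cw : 'rV['Z_N]_d.+1 * {ffun 'I_d.+1 -> 'I_K.+1} |
        (cw.1 \in C) && (\sum_i cw.2 i + height cw.1 == k)%N]|.
Proof.
case: k => [|k] N1 kK C0 sum0 /=; last exact: ehrhart_code_simplex.
rewrite (_ : [set _ | _]%SET = [set (0, [ffun=> ord0])]) ?cards1 //.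
apply/setP => -[c w]; rewrite !inE /=.
apply/andP/eqP => [[cC]|[-> ->]]; last first.
  split=> //; rewrite addn_eq0; apply/andP; split.
    by apply/eqP; rewrite big1 // => i _; rewrite ffunE.
  by rewrite /height big1 ?div0n // => i _; rewrite mxE.
rewrite addn_eq0 sum_nat_eq0 => /andP[/forallP w0 /eqP h0].
congr pair; last by apply/ffunP => i; rewrite ffunE; apply/val_inj/eqP/w0.
by apply/eqP; rewrite -row_sum_eq0 height_mul ?sum0 // h0.
Qed.

(** * The h*-polynomial as the height enumerator of the code *)

Lemma exp_one_subXn (A : comNzRingType) (K n : nat) :
  exists q : {poly A}, (1 - 'X^K) ^+ n = 1 + q * 'X^K.
Proof.
elim: n => [|n [q IHn]]; first by exists 0; rewrite expr0 mul0r addr0.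
by exists (q - 1 - q * 'X^K); rewrite exprS IHn; ring.
Qed.

(* Truncating the geometric series at degree K does not affect the coefficients
   of degree at most K, which makes power series unnecessary. *)
Lemma code_hstarE (R : realType) (N d : nat) (C : {set 'rV['Z_N]_d.+1}) :
  (1 < N)%N -> 0 \in C ->
  (forall c, c \in C -> (N %| \sum_i (c ord0 i : nat))%N) ->
  code_hstar R N C (\sum_(c in C) 'X^(height c)).
Proof.
move=> N1 C0 sum0 K; set H := \sum_(c in C) _.
pose G : {poly rat} := \sum_(j < K.+1) 'X^j.
have GE : (1 - 'X) * G = 1 - 'X^(K.+1).
  by rewrite -opprB mulNr -subrX1 opprB.
have HGE k : (k <= K)%N ->
    (ehrhart_series (code_simplex R N d) (code_lattice R N C)
       (simplex_vertex R N ord0) k)%:R = (H * G ^+ d.+1)`_k :> rat.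
  move=> kK; rewrite (ehrhart_series_code_simplex _ N1 kK) //.
  (* Expanding the power chooses one exponent in each of the [d.+1] factors, that is, a vector
     [w]. *)
  have -> : G ^+ d.+1 = \sum_(w : {ffun 'I_d.+1 -> 'I_K.+1}) 'X^(\sum_i w i).
    rewrite -[in LHS](card_ord d.+1) -prodr_const bigA_distr_bigA /=.
    by apply: eq_bigr => w _; rewrite expr_sum.
  rewrite /H big_distrlr /= pair_big_dep /= coef_sum -sum1_card natr_sum.
  rewrite big_mkcond [RHS]big_mkcond /=; apply: eq_bigr => -[c w] _.
  rewrite inE /= andbT -exprD coefXn addnC.
  by case: (c \in C) => //=; rewrite eq_sym; case: eqP.
transitivity (((1 - 'X) ^+ d.+1 * (H * G ^+ d.+1))`_K); last first.
  rewrite coefM; apply: eq_bigr => i _; rewrite HGE //; exact: leq_subr.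
(* The product of the two powers is a power of [1 - 'X^(K.+1)], thus 1 up to a multiple of
   ['X^(K.+1)], which is invisible in degree [K]. *)
rewrite mulrCA -exprMn GE.
have [q ->] := exp_one_subXn rat K.+1 d.+1.
by rewrite mulrDr mulr1 coefD mulrA coefMXn ltnSn addr0.
Qed.

(** * Heights of the words of the code of [g] *)

(** The first row of [g] matters only through the parity of its coefficient, so a boolean and a
    residue parametrise the code without repetition for even [N]. *)
Definition gen_g_word (N : nat) (ey : bool * 'Z_N) : 'rV['Z_N]_5 :=
  let M2 : 'Z_N := N./2%:R in
  row5 (M2 * (ey.1%:R + ey.2)) (M2 * ey.1%:R) (M2 * ey.2) ey.2 (- ey.2).

Lemma half_neq0 (N : nat) : (1 < N)%N -> N./2%:R != 0 :> 'Z_N.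
Proof.
move=> N1; rewrite -val_eqE /= val_Zp_nat // modn_small; lia.
Qed.

Lemma gen_g_word_inj (N : nat) : (1 < N)%N -> injective (@gen_g_word N).
Proof.
move=> N1 [e y] [e' y'] /rowP eq_w.
move: (eq_w (@Ordinal 5 3 isT)) (eq_w (@Ordinal 5 1 isT)).
rewrite !mxE /= => <-.
case: e e' {eq_w} => [] [] //= /eqP; rewrite mulr1 mulr0 ?[0 == _]eq_sym;
  by rewrite (negPf (half_neq0 N1)).
Qed.

Lemma row_code_gen_g_imset (N : nat) : (1 < N)%N -> ~~ odd N ->
  row_code (gen_g N) = [set gen_g_word ey | ey : bool * 'Z_N].
Proof.
move=> N1 Ne; apply/setP => c.
apply/(row_code_gen_gP _ N1)/imsetP => [[x [y ->]]|[[e y] _ ->]]; last first.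
  by exists e%:R, y.
exists (odd x, y) => //; rewrite /gen_g_word /= !mulrDr !(half_mulE x) //.
by rewrite [_ * (odd x)%:R]mulrC.
Qed.

Lemma val_half_mul_nat (N : nat) (m : nat) : (1 < N)%N -> ~~ odd N ->
  (N./2%:R * m%:R : 'Z_N) = (odd m * N./2)%N :> nat.
Proof.
move=> N1 Ne; rewrite -natrM val_Zp_nat //.
have -> : (N./2 * m = m./2 * N + odd m * N./2)%N by nia.
by rewrite modnMDl modn_small //; case: odd; lia.
Qed.

Lemma val_Zp_opp (N : nat) (y : 'Z_N) : (1 < N)%N ->
  (- y : 'Z_N) = (if y == 0 then 0%N else (N - y)%N) :> nat.
Proof.
move=> N1; have [->|y0] := eqVneq y 0; first by rewrite oppr0.
have yN := ltn_Zp y N1.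
have -> : - y = (N - y)%:R.
  by rewrite natrB ?(ltnW yN) // pchar_Zp // natr_Zp sub0r.
rewrite val_Zp_nat // modn_small //.
move: y0; rewrite -val_eqE /=; lia.
Qed.

Lemma sum_row5 (N : nat) (a b c d e : 'Z_N) :
  (\sum_i (row5 a b c d e ord0 i : nat) = a + b + c + d + e)%N.
Proof. by rewrite !big_ord_recl big_ord0 !mxE /= addn0 !addnA. Qed.

(** The last two letters add up to [N] unless [y = 0]. The first three give [N / 2] for each odd
    number among [e + y], [e], [y]: there are two of these, or none when [e] and [y] are both
    even. *)
Lemma sum_gen_g_word (N : nat) (e : bool) (y : 'Z_N) : (1 < N)%N -> ~~ odd N ->
  (\sum_i (gen_g_word (e, y) ord0 i : nat)
   = (if odd y then 2 else e + (y != 0 :> nat)) * N)%N.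
Proof.
move=> N1 Ne; rewrite sum_row5 [RHS]/= val_Zp_opp //.
have -> : e%:R + y = (e + y)%N%:R by rewrite natrD natr_Zp.
have -> : (N./2%:R * y : 'Z_N) = (odd y * N./2)%N :> nat.
  by rewrite -val_half_mul_nat // natr_Zp.
rewrite !val_half_mul_nat // oddD oddb -val_eqE /=.
have := ltn_Zp y N1.
case: eqP => [->|]; case: e; case yo: (odd y) => /=; lia.
Qed.

(** The induction adds two residues at a time: a nonzero even [y] contributes ['X + 'X^2] and an odd
    one twice ['X^2], while [y = 0] gives [1 + 'X]. *)
Lemma sum_X_gen_g_height (m : nat) :
  \sum_(0 <= y < m.+1.*2) \sum_(e : bool)
     'X^(if odd y then 2 else e + (y != 0))%N
  = 'X^2 *+ (3 * m + 2) + 'X *+ m.+1 + 1 :> {poly rat}.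
Proof.
elim: m => [|m IHm].
  rewrite !big_nat_recr //= big_geq // !big_bool /=; ring.
rewrite doubleS big_nat_recr // big_nat_recr // {}IHm !big_bool /=.
rewrite odd_double /=.
rewrite (_ : 3 * m.+1 + 2 = (3 * m + 2) + 3)%N; last by lia.
by rewrite mulrnDr [_ *+ m.+2]mulrS; ring.
Qed.

Lemma code_hstar_gen_g (R : realType) (N : nat) : (1 < N)%N -> ~~ odd N ->
  code_hstar R N (row_code (gen_g N))
    ((3 * N%:R / 2 - 1) *: 'X^2 + (N%:R / 2) *: 'X + 1).
Proof.
move=> N1 Ne.
have -> : (3 * N%:R / 2 - 1) *: 'X^2 + (N%:R / 2) *: 'X + 1
   = \sum_(c in row_code (gen_g N)) 'X^(height c) :> {poly rat}.
  rewrite row_code_gen_g_imset // big_imset /=; last first.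
    by move=> u v _ _; exact: gen_g_word_inj.
  transitivity (\sum_(y : 'Z_N) \sum_(e : bool)
      'X^(if odd y then 2 else e + (y != 0 :> nat))%N : {poly rat}).
    rewrite -(big_mkord xpredT (fun y => \sum_(e : bool)
      'X^(if odd y then 2 else e + (y != 0 :> nat))%N : {poly rat})) Zp_cast //.
    (* With [N = 2 (m + 1)], the coefficients [3 m + 2] and [m + 1] become [3 N / 2 - 1] and
       [N / 2]. *)
    have [m NE] : exists m, N = m.+1.*2 by exists N./2.-1; lia.
    rewrite NE sum_X_gen_g_height -!scaler_nat -!muln2 !natrM !natrD.
    congr (_ *: _ + _ *: _ + _); rewrite ?natrM -?natr1; by field.
  rewrite exchange_big /= pair_big /=; apply: eq_big => [ey|[e y] _].
    by rewrite inE.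
  by rewrite /height sum_gen_g_word // mulnK // ltnW.
apply: code_hstarE => // [|c].
  have [_ [] //] := row_code_linear (gen_g N) N1.
rewrite row_code_gen_g_imset // => /imsetP[[e y] _ ->].
by rewrite sum_gen_g_word // dvdn_mull.
Qed.

Theorem lemma3p9 (R : realType) (N : nat) (N_ge2 : (2 <= N)%N)
    (N_even : ~~ odd N) :
  (forall b1 b2 : 'Z_N,
     (b1, b2) != (0, 0) ->
     gcdn (gcdn b1 b2) N./2 = 1%N ->
     is_direct_sum N (row_code (gen_b b1 b2))
     \/ code_iso (row_code (gen_b b1 b2)) (row_code (gen_g N)))
  /\ code_hstar R N (row_code (gen_g N))
       ((3 * N%:R / 2 - 1) *: 'X^2 + (N%:R / 2) *: 'X + 1).
Proof.
split; last exact: code_hstar_gen_g.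
move=> b1 b2 b_neq0 gcd1; have cop : coprime (gcdn b1 b2) N./2 by apply/eqP.
have [b_odd|] := boolP (odd b1 || odd b2).
  by right; apply: gen_b_iso_gen_g.
rewrite negb_or => /andP[b1e b2e]; left; apply: gen_b_direct_sum => //.
(* For [N = 2] the only even residue is 0, so a nonzero pair of even residues forces [N > 2]. *)
move: b_neq0; rewrite xpair_eqE -!val_eqE /=.
have := ltn_Zp b1 N_ge2; have := ltn_Zp b2 N_ge2; lia.
Qed.
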